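(* Let $V$ be a vector space over a field $K$ and let $f$ be a locally nilpotent endomorphism of $V$. Suppose that $V$ has a decomposition $$V = \bigoplus_{j \in \mathbb{N}} V_{t_j}, \qquad V_{t_j} = \bigoplus_{\sigma \in S_j} V_{t_j\sigma},$$ where $(t_j)_{j\in\mathbb{N}}$ is a sequence of positive integers with $t_j < t_{j+1}$ for all $j \in \mathbb{N}$, each $S_j$ is a nonempty (possibly infinite) index set, and each $V_{t_j\sigma}$ is an $f$-invariant subspace of $V$ which, as a $K[s]$-module with $s$ acting as $f$, satisfies $V_{t_j\sigma} \cong K[s]/s^{t_j}K[s]$ (that is, $V_{t_j\sigma}$ is an $f$-cyclic subspace of dimension $t_j$). Then for a subspace $X \subseteq V$ the following statements are equivalent. (i) $X$ is hyperinvariant with respect to $f$. (ii) There exists a sequence of integers $(r_j)_{j\in\mathbb{N}}$ satisfying $$0 \le r_j \le t_j \quad \text{for all } j \in \mathbb{N},$$ and $$r_j \le r_\ell \quad \text{and} \quad t_j - r_j \le t_\ell - r_\ell \quad \text{whenever } j \le \ell,$$ such that $$X = \bigoplus_{j \in \mathbb{N}} f^{r_j} V_{t_j}.$$ (iii) There exists a sequence of integers $(r_j)_{j\in\mathbb{N}}$ satisfying $$0 \le r_j \le t_j \quad \text{for all } j \in \mathbb{N},$$ and $$r_j \le r_\ell \quad \text{and} \quad t_j - r_j \le t_\ell - r_\ell \quad \text{whenever } j \le \ell,$$ such that $$X = \sum_{j \in \mathbb{N}} \left( \operatorname{Im} f^{r_j} \cap \operatorname{Ker} f^{t_j - r_j}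 \right).$$
   Context: Here $\mathbb{N} = \{1,2,3,\dots\}$. An endomorphism $f$ of a vector space $V$ is locally nilpotent if every $x \in V$ is annihilated by some power of $f$ (the power may depend on $x$). A subspace $X$ of $V$ is hyperinvariant with respect to $f$ if $X$ is invariant under every endomorphism of $V$ that commutes with $f$. For $x \in V$, the $f$-cyclic subspace generated by $x$ is $\langle x\rangle = \operatorname{span}\{f^i x : i \ge 0\}$. By convention $f^0$ is the identity. $\operatorname{Im} f^{p} = f^pV$ and $\operatorname{Ker} f^{q}$ are the image and kernel of the powers of $f$ on all of $V$. *)

(* Defs.v *)
From HB Require Import structures.
From mathcomp Require Import all_boot all_order all_algebra.
From mathcomp Require Import boolp classical_sets.

Set Implicit Arguments.
Unset Strict Implicit.
Unset Printing Implicit Defensive.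

Import GRing.Theory.
Local Open Scope classical_set_scope.
Local Open Scope ring_scope.

Section Subspaces.
Context {K : fieldType} {V : lmodType K}.

Definition is_subspace (X : set V) : Prop := submod_closed [in X].

Definition span_set (G : set V) : set V := smallest is_subspace G.

Definition subspace_sum {I : Type} (W : I -> set V) : set V :=
  span_set (\bigcup_(i in [set: I]) W i).

Definition is_direct_sum {I : Type} (W : I -> set V) (X : set V) : Prop :=
  X = subspace_sum W /\
  forall i, W i `&` span_set (\bigcup_(k in [set k | k <> i]) W k) `<=` [set 0].

End Subspaces.

Section Endomorphisms.
Context {K : fieldType} {V : lmodType K} (f : {linear V -> V}).

Definition locally_nilpotent : Prop := forall x : V, exists n, iter n f x = 0.

Definition invariant_under (X : set V) : Prop := f @` X `<=` X.

Definition im_pow (n : nat) : set V := range (iter n f).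

Definition ker_pow (n : nat) : set V := [set x | iter n f x = 0].

(* The action of p(f) on x, i.e. the K[s]-module structure in which s acts as
   f. *)
Definition poly_act (p : {poly K}) (x : V) : V :=
  \sum_(i < size p) p`_i *: iter i f x.

(* [W] is isomorphic to K[s]/s^t K[s] as a K[s]-module.  Only meant for
   [0 < t]: [{poly %/ h}] is the quotient by [h] for monic nonconstant [h], but
   [{poly %/ 1}] is the quotient by ['X]. *)
Definition iso_quotXn (t : nat) (W : set V) : Prop :=
  exists phi : {additive {poly %/ ('X^t : {poly K})} -> V},
    [/\ forall (p : {poly K}) q, phi (in_qpoly 'X^t p * q) = poly_act p (phi q),
        injective phi
      & range phi = W].

End Endomorphisms.

Definition hyperinvariant {K : fieldType} {V : lmodType K}
    (f : {linear V -> V}) (X : set V) : Prop :=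
  is_subspace X /\
  forall g : {linear V -> V}, g \o f =1 f \o g -> invariant_under g X.

Definition admissible (t r : nat -> nat) : Prop :=
  (forall j, (r j <= t j)%N) /\
  (forall j l, (j <= l)%N -> (r j <= r l)%N /\ (t j - r j <= t l - r l)%N).

(* Main.v *)
Require Import Defs.
From HB Require Import structures.
From mathcomp Require Import all_boot all_order all_algebra.
From mathcomp Require Import boolp classical_sets.
From mathcomp Require Import zify.

Set Implicit Arguments.
Unset Strict Implicit.
Unset Printing Implicit Defensive.

Import GRing.Theory.
Local Open Scope classical_set_scope.
Local Open Scope ring_scope.

(** Refine the two-step decomposition to a single one, V = \bigoplus_a W_a with
    a = (j, s), and let e_a be the generator of W_a corresponding to 1 in
    K[s]/(s^(t_j)).  All the endomorphisms commuting with f that are needed come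
    from one extension principle: if f^(t_j) y = 0 then there is an endomorphism
    commuting with f that sends e_a to y and kills every other summand
    ([exists_commuting_map]).  The case y = e_a gives the projection onto W_a.

    Let X be hyperinvariant.  The projections map X to itself, so X is generated
    by the intersections of X with the W_a ([hyperinvariant_generated]).  Inside
    a single W_a, an f-invariant subspace containing sum_i c_i f^i e_a contains
    every f^i e_a with c_i != 0 ([iter_mem_of_comb]), hence the intersection of
    X and W_a is f^r W_a, where r is least with f^r e_a in X.  Sending e_a to
    f^d e_b, possible as soon as dim W_b <= dim W_a + d
    ([hyperinvariant_transfer]), compares these exponents: d = 0 inside one block shows that r depends on j only, d = 0
    from a longer to a shorter summand gives r_j <= r_l, and d = t_l - t_j from
    a shorter to a longer one gives t_j - r_j <= t_l - r_l.  This is (i) => (ii).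

    For an admissible r the subspaces in (ii) and (iii) are the same
    ([block_sum_im_ker]).  If f^(t_j) v = 0, the hyperinvariant subspace
    Ker f^(t_j) contains the components of v, and the component in a block l is
    divisible by f^(t_l - t_j); since r_l <= r_j + (t_l - t_j), applying f^(r_j)
    puts it in f^(r_l) V_(t_l).  Here the truncated difference covers both
    l <= j and j <= l.  Finally (iii) => (i) because images and kernels of
    powers of f are hyperinvariant, and intersections and sums of hyperinvariant
    subspaces are hyperinvariant. *)

(** * Subspaces, direct sums and linear graphs *)

Section Subspaces.
Context {K : fieldType} {V : lmodType K}.
Implicit Types (X Y G : set V) (x y : V) (a : K).

Lemma is_subspaceP X :
  is_subspace X <-> X 0 /\ forall a x y, X x -> X y -> X (a *: x + y).
Proof.
rewrite /is_subspace; split=> -[X0 Xlin]; split.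
- by move: X0; rewrite !inE.
- by move=> a x y Xx Xy; have := Xlin a x y; rewrite !inE; apply.
- by rewrite !inE.
- by move=> a x y; rewrite !inE; apply: Xlin.
Qed.

Lemma subspace0 X : is_subspace X -> X 0.
Proof. by case/is_subspaceP. Qed.

Lemma subspaceD X x y : is_subspace X -> X x -> X y -> X (x + y).
Proof. by case/is_subspaceP=> _ Xlin; rewrite -{2}[x]scale1r; apply: Xlin. Qed.

Lemma subspaceZ X a x : is_subspace X -> X x -> X (a *: x).
Proof.
by case/is_subspaceP=> X0 Xlin Xx; rewrite -[_ *: _]addr0; apply: Xlin.
Qed.

Lemma subspaceN X x : is_subspace X -> X x -> X (- x).
Proof. by rewrite -scaleN1r; apply: subspaceZ. Qed.

Lemma subspace_big X (I : Type) (s : seq I) (P : pred I) (F : I -> V) :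
  is_subspace X -> (forall i, P i -> X (F i)) -> X (\sum_(i <- s | P i) F i).
Proof.
move=> Xsub XF; elim/big_ind: _ => [|x y|//]; first exact: subspace0.
exact: subspaceD.
Qed.

Lemma subspace_preimage (g : {linear V -> V}) X :
  is_subspace X -> is_subspace [set x | X (g x)].
Proof.
case/is_subspaceP=> X0 Xlin; apply/is_subspaceP; split=> [|a x y] /=.
  by rewrite linear0.
by rewrite linearP; apply: Xlin.
Qed.

Lemma subspace_image (g : {linear V -> V}) X :
  is_subspace X -> is_subspace (g @` X).
Proof.
case/is_subspaceP=> X0 Xlin; apply/is_subspaceP; split.
  by exists 0; rewrite ?linear0.
move=> a _ _ [x Xx <-] [y Xy <-].
by exists (a *: x + y); rewrite ?linearP; first exact: Xlin.
Qed.

Lemma span_setP G : is_subspace (span_set G).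
Proof.
apply/is_subspaceP; split=> [Y [/subspace0]//|a x y Gx Gy Y [Ysub GY]].
by case/is_subspaceP: (Ysub) => _; apply; [apply: Gx | apply: Gy].
Qed.

Lemma span_set_sub G Y : is_subspace Y -> G `<=` Y -> span_set G `<=` Y.
Proof. exact: smallest_sub. Qed.

Lemma sub_span_set G : G `<=` span_set G.
Proof. exact: sub_gen_smallest. Qed.

Lemma subspace_sum_sub (I : Type) (W : I -> set V) Y :
  is_subspace Y -> (forall i, W i `<=` Y) -> subspace_sum W `<=` Y.
Proof. by move=> Ysub WY; apply: span_set_sub => // x [i _]; apply: WY. Qed.

Lemma sub_subspace_sum (I : Type) (W : I -> set V) i :
  W i `<=` subspace_sum W.
Proof. by move=> x Wx; apply: sub_span_set; exists i. Qed.

Lemma is_direct_sum_sub (I : Type) (W W' : I -> set V) X :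
  is_direct_sum W X -> (forall i, W' i `<=` W i) ->
  is_direct_sum W' (subspace_sum W').
Proof.
move=> [_ indep] sW'W; split=> // i x [Wx others]; apply: (indep i); split.
  exact: sW'W.
apply: (span_set_sub (span_setP _)) others => y [k ik Wy].
by apply: sub_span_set; exists k => //; apply: sW'W.
Qed.

(** Suppose w lies in one summand W i s and in the span of all the others.  Split
    the latter membership into a part u from the other summands of U i and a
    part v from the other blocks: v = w - u lies in U i, so it vanishes by
    independence of the blocks, and then w = u vanishes inside U i. *)
Lemma is_direct_sum_sigma (I : Type) (S : I -> Type)
    (W : forall i, S i -> set V) (U : I -> set V) X :
  (forall i, is_direct_sum (W i) (U i)) -> is_direct_sum U X ->
  is_direct_sum (fun a : {i : I & S i} => W (tag a) (tagged a)) X.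
Proof.
move=> dirW [-> indepU].
have Usub i : is_subspace (U i) by case: (dirW i) => -> _; apply: span_setP.
have WU i s : W i s `<=` U i.
  by case: (dirW i) => -> _; apply: sub_subspace_sum.
split.
  apply/seteqP; split; apply: subspace_sum_sub; try exact: span_setP.
    move=> i; case: (dirW i) => -> _; apply: subspace_sum_sub => [|s x Wx].
      exact: span_setP.
    by apply: sub_span_set; exists (existT _ i s).
  by case=> i s x Wx; apply: sub_span_set; exists i => //; apply: WU Wx.
case=> i s x /= [Wx others].
pose A := span_set (\bigcup_(k in [set k | k <> s]) W i k).
pose B := span_set (\bigcup_(k in [set k | k <> i]) U k).
have Asub : is_subspace A by apply: span_setP.
have Bsub : is_subspace B by apply: span_setP.
have [u Au [v Bv xE]] : exists2 u, A u & exists2 v, B v & x = u + v.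
  move: others; apply: (span_set_sub (Y := [set x | exists2 u, A u &
    exists2 v, B v & x = u + v])) => [|y [[k s'] /= ne Wy]].
    apply/is_subspaceP; split.
      exists 0; first exact: subspace0 Asub.
      by exists 0; rewrite ?addr0 //; apply: subspace0 Bsub.
    move=> a _ _ [u Au [v Bv ->]] [u' Au' [v' Bv' ->]].
    exists (a *: u + u').
      exact: subspaceD Asub (subspaceZ _ Asub _) _.
    exists (a *: v + v').
      exact: subspaceD Bsub (subspaceZ _ Bsub _) _.
    by rewrite scalerDr addrACA.
  have [ki|nki] := EM (k = i).
    subst k; exists y; last by exists 0; rewrite ?addr0 //;
      apply: subspace0 Bsub.
    by apply: sub_span_set; exists s' => //= E; apply: ne; rewrite E.
  exists 0; first exact: subspace0 Asub.
  exists y; rewrite ?add0r //.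
  by apply: sub_span_set; exists k => //; apply: WU Wy.
have AU : A `<=` U i.
  by apply: span_set_sub => // y [k _]; apply: WU.
have v0 : v = 0.
  suff uBv : [set 0 : V] v by exact: uBv.
  apply: (indepU i v); split=> //.
  have -> : v = x - u by rewrite xE addrAC subrr add0r.
  by apply: subspaceD => //; [exact: WU Wx | apply: subspaceN => //; apply: AU].
case: (dirW i) => _ /(_ s); apply; split=> //.
by rewrite xE v0 addr0.
Qed.

(** Linear maps on V are built below from their values on the summands; a
    relation avoids choosing coordinates of each vector. *)
Lemma linear_of_graph (R : V -> V -> Prop) :
  (forall a x z x' z', R x z -> R x' z' -> R (a *: x + x') (a *: z + z')) ->
  (forall x, exists z, R x z) -> (forall z, R 0 z -> z = 0) ->
  exists g : {linear V -> V}, forall x z, R x z <-> z = g x.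
Proof.
move=> Rlin Rtot R0; have [g Rg] := choice Rtot.
have Rfun x z : R x z -> z = g x.
  move=> Rxz; have := Rlin (-1) _ _ _ _ Rxz (Rg x).
  by rewrite !scaleN1r addNr => /R0/eqP; rewrite addrC subr_eq0 => /eqP.
have glin : linear g.
  by move=> a x y; apply/esym/Rfun/Rlin; apply: Rg.
pose G : {linear V -> V} :=
  HB.pack g (GRing.isLinear.Build K V V *:%R g glin).
by exists G => x z; split=> [/Rfun //|->]; apply: Rg.
Qed.

End Subspaces.

(** * Combinations of the iterates of a vector *)

Section Cyclic.
Context {K : fieldType} {V : lmodType K} (f : {linear V -> V}).
Implicit Types (X W : set V) (t n m : nat) (c : nat -> K) (e x y : V).

Lemma iter_is_linear n : linear (iter n f).
Proof.
by elim: n => [|n IHn] a x y //=; rewrite -[LHS]/(f (iter n f _)) IHn linearP.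
Qed.

HB.instance Definition _ n :=
  GRing.isLinear.Build K V V *:%R (iter n f) (iter_is_linear n).

Lemma iter_eq0W n m x : (n <= m)%N -> iter n f x = 0 -> iter m f x = 0.
Proof. by move=> /subnK <- x0; rewrite iterD x0 linear0. Qed.

Lemma iter_commute (g : {linear V -> V}) n x :
  g \o f =1 f \o g -> g (iter n f x) = iter n f (g x).
Proof.
move=> gf; elim: n => //= n IHn.
by rewrite -[LHS]/((g \o f) _) gf /= IHn.
Qed.

Lemma iter_invariant X n x : invariant_under f X -> X x -> X (iter n f x).
Proof. by move=> Xf Xx; elim: n => //= n IHn; apply: Xf; exists (iter n f x). Qed.

(** The action on y of the polynomial of degree less than t with coefficients c;
    functions nat -> K make shifts and zero coefficients easier to handle than
    polynomials do. *)
Definition comb t c y := \sum_(i < t) c i *: iter i f y.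

Lemma comb_linear t a c d y :
  comb t (fun i => a * c i + d i) y = a *: comb t c y + comb t d y.
Proof.
rewrite /comb scaler_sumr -big_split /=.
by apply: eq_bigr => i _; rewrite scalerDl scalerA.
Qed.

Lemma comb0 t y : comb t (fun=> 0) y = 0.
Proof. by rewrite /comb big1 // => i _; rewrite scale0r. Qed.

Lemma comb_delta t y : (0 < t)%N -> comb t (fun i => (i == 0%N)%:R) y = y.
Proof.
case: t => // t _; rewrite /comb big_ord_recl big1 => [|i _].
  by rewrite addr0 scale1r.
by rewrite scale0r.
Qed.

Lemma comb_shift t c y : iter t f y = 0 ->
  f (comb t c y) = comb t (fun i => if i is j.+1 then c j else 0) y.
Proof.
case: t => [|t] y0; first by rewrite /comb !big_ord0 linear0.
rewrite /comb linear_sum big_ord_recr [RHS]big_ord_recl /= linearZ /=.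
rewrite -[f (iter t f y)]/(iter t.+1 f y) y0 scaler0 addr0 scale0r add0r.
by apply: eq_bigr => i _; rewrite linearZ.
Qed.

Lemma comb_commute (g : {linear V -> V}) t c y :
  g \o f =1 f \o g -> g (comb t c y) = comb t c (g y).
Proof.
move=> gf; rewrite /comb linear_sum; apply: eq_bigr => i _.
by rewrite linearZ /= iter_commute.
Qed.

Lemma comb_mem X t c y :
  is_subspace X -> invariant_under f X -> X y -> X (comb t c y).
Proof.
move=> Xsub Xf Xy; apply: subspace_big => // i _; apply: subspaceZ => //.
exact: iter_invariant.
Qed.

(** Let k0 be the least index with a nonzero coefficient.  For k0 <= m < t, the
    vector f^(m - k0) (comb t c e) lies in X and equals c_k0 f^m e up to iterates
    of e of order above m, so f^m e lies in X for all m >= k0 by descending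
    induction on m, starting from f^t e = 0. *)
Lemma iter_mem_of_comb X t c e k :
  is_subspace X -> invariant_under f X -> iter t f e = 0 ->
  X (comb t c e) -> (k < t)%N -> c k != 0 -> X (iter k f e).
Proof.
move=> Xsub Xf e0 Xc lt_kt ck.
have exk : exists i, (i < t)%N && (c i != 0) by exists k; rewrite lt_kt.
case: (ex_minnP exk) => k0 /andP[lt_k0 ck0] min_k0.
suff Xm d m : (t - m <= d)%N -> (k0 <= m)%N -> X (iter m f e).
  by apply: (Xm t) => //; [apply: leq_subr | apply: min_k0; rewrite lt_kt].
have Xbig i : (t <= i)%N -> X (iter i f e).
  by move=> le_ti; rewrite (iter_eq0W le_ti e0); apply: subspace0.
elim: d m => [|d IHd] m le_d le_k0.
  by apply: Xbig; rewrite -subn_eq0 -leqn0.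
have [/Xbig //|lt_mt] := leqP t m.
have := iter_invariant (m - k0) Xf Xc.
rewrite /comb linear_sum (bigD1 (Ordinal lt_k0)) //= linearZ /=.
rewrite -iterD subnK //; set rest := \sum_(i < t | _) _.
have Xrest : X rest.
  apply: subspace_big => // i ne_i; rewrite linearZ /= -iterD.
  have [->|ci] := eqVneq (c i) 0; first by rewrite scale0r; apply: subspace0.
  have lt_k0i : (k0 < i)%N.
    rewrite ltn_neqAle min_k0 ?ltn_ord // andbT.
    by apply: contraNneq ne_i => k0i; apply/eqP/val_inj.
  have lt_m : (m < m - k0 + i)%N by rewrite -{1}(subnK le_k0) ltn_add2l.
  apply: subspaceZ => //; apply: IHd; last exact: leq_trans le_k0 (ltnW lt_m).
  by rewrite -ltnS; apply: leq_trans le_d; rewrite ltn_sub2l.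
move=> Xsum; have : X ((c k0)^-1 *: (c k0 *: iter m f e + rest - rest)).
  by apply: subspaceZ => //; apply: subspaceD => //; apply: subspaceN.
by rewrite addrK scalerA mulVf // scale1r.
Qed.


(** * Cyclic subspaces *)

Lemma mem_iter_image_comb W t c e r :
  is_subspace W -> invariant_under f W -> W e ->
  (forall i, (i < t)%N -> c i != 0 -> (r <= i)%N) ->
  (iter r f @` W) (comb t c e).
Proof.
move=> Wsub Wf We le_r.
have rWsub : is_subspace (iter r f @` W).
  exact: (@subspace_image _ _ (iter r f)).
apply: subspace_big => // i _.
have [->|ci] := eqVneq (c i) 0; first by rewrite scale0r; apply: subspace0.
apply: subspaceZ => //; exists (iter (i - r) f e); first exact: iter_invariant.
by rewrite -iterD subnKC // le_r.
Qed.

(** The vectors f^i e, i < t, form a basis of W and f^t e = 0: this is what it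
    means for e to correspond to 1 under an isomorphism W = K[s]/(s^t). *)
Definition cyclic_generator t e W : Prop :=
  [/\ W e, iter t f e = 0,
      forall w, W w -> exists c, w = comb t c e
    & forall c, comb t c e = 0 -> forall i, (i < t)%N -> c i = 0].

Lemma poly_act_comb (p : {poly K}) t x :
  (size p <= t)%N -> poly_act f p x = comb t (fun i => p`_i) x.
Proof.
move=> le_pt; rewrite /poly_act /comb.
rewrite (big_ord_widen t (fun i => p`_i *: iter i f x) le_pt) big_mkcond.
apply: eq_bigr => i _; case: ltnP => // /(nth_default 0) ->.
by rewrite scale0r.
Qed.

Lemma iso_quotXn_cyclic t W :
  (0 < t)%N -> iso_quotXn f t W -> exists e, cyclic_generator t e W.
Proof.
move=> t_gt0 [phi [phiM phi_inj phiW]].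
(* As t > 0, X^t is monic and nonconstant, so the quotient is by X^t itself. *)
have hE : mk_monic ('X^t : {poly K}) = 'X^t.
  by rewrite /mk_monic size_polyXn ltnS t_gt0 monicXn.
have phiE p : phi (in_qpoly 'X^t p) = poly_act f p (phi 1).
  by rewrite -phiM mulr1.
have small (p : {poly K}) : (size p <= t)%N -> in_qpoly 'X^t p = p :> {poly K}.
  by move=> le_pt; apply: in_qpoly_small; rewrite hE size_polyXn ltnS.
have qpoly_inj (p q : {poly %/ ('X^t : {poly K})}) : p = q :> {poly K} -> p = q.
  by move=> /val_inj.
exists (phi 1); split.
- by rewrite -phiW; exists 1.
- transitivity (poly_act f 'X^t (phi 1)).
    rewrite (@poly_act_comb _ t.+1) ?size_polyXn // /comb big_ord_recr /=.
    rewrite coefXn eqxx scale1r big1 ?add0r // => i _.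
    by rewrite coefXn ltn_eqF ?ltn_ord // scale0r.
  rewrite -phiE; have -> : in_qpoly ('X^t : {poly K}) 'X^t = 0; last exact: raddf0.
  by apply: qpoly_inj; rewrite /= hE Pdiv.RingMonic.rmodpp ?monicXn.
- rewrite -phiW => _ [q _ <-].
  have le_qt : (size (q : {poly K}) <= t)%N.
    by apply: leq_trans (size_npoly q) _; rewrite hE size_polyXn.
  exists (fun i => (q : {poly K})`_i).
  by rewrite -poly_act_comb // -phiE; congr (phi _); apply: qpoly_inj; rewrite small.
move=> c c0 i lt_it; pose p := \poly_(j < t) c j.
have le_pt : (size p <= t)%N by apply: size_poly.
suff p0 : p = 0.
  by have := coef_poly t c i; rewrite lt_it -/p p0 coef0 => <-.
rewrite -(small p le_pt).
have -> : in_qpoly ('X^t : {poly K}) p = 0; last by [].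
apply: phi_inj; rewrite raddf0 phiE (poly_act_comb _ le_pt) -[RHS]c0.
by apply: eq_bigr => j _; rewrite coef_poly ltn_ord.
Qed.

(** * Hyperinvariant subspaces *)

Lemma hyperinvariant_inv X : hyperinvariant f X -> invariant_under f X.
Proof. by case=> _; apply. Qed.

Lemma hyperinvariant_mem X (g : {linear V -> V}) x :
  hyperinvariant f X -> g \o f =1 f \o g -> X x -> X (g x).
Proof. by case=> _ Xg gf Xx; apply: Xg gf _ _; exists x. Qed.

Lemma hyperinvariant_sum (I : Type) (Y : I -> set V) :
  (forall i, hyperinvariant f (Y i)) -> hyperinvariant f (subspace_sum Y).
Proof.
move=> Yhyp; split=> [|g gf _ [x Yx <-]]; first exact: span_setP.
apply: (subspace_sum_sub (Y := [set x | subspace_sum Y (g x)])) Yx => [|i y Yy].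
  exact/subspace_preimage/span_setP.
by apply: (sub_subspace_sum (i := i)); apply: hyperinvariant_mem.
Qed.

Lemma hyperinvariant_ker_pow n : hyperinvariant f (ker_pow f n).
Proof.
split=> [|g gf _ [x x0 <-]]; last by rewrite /ker_pow /= -iter_commute // x0 linear0.
apply/is_subspaceP; split=> [|a x y /= x0 y0]; first exact: linear0.
by rewrite /ker_pow /= linearP /= x0 y0 scaler0 addr0.
Qed.

Lemma hyperinvariant_im_pow n : hyperinvariant f (im_pow f n).
Proof.
split=> [|g gf _ [_ [x _ <-] <-]]; last by exists (g x); rewrite ?iter_commute.
apply: (@subspace_image _ _ (iter n f)); exact/is_subspaceP.
Qed.

Lemma hyperinvariantI X Y :
  hyperinvariant f X -> hyperinvariant f Y -> hyperinvariant f (X `&` Y).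
Proof.
move=> [/is_subspaceP[X0 Xlin] Xg] [/is_subspaceP[Y0 Ylin] Yg]; split.
  apply/is_subspaceP; split=> // a x y [Xx Yx] [Xy Yy].
  by split; [apply: Xlin | apply: Ylin].
move=> g gf _ [x [Xx Yx] <-].
by split; [apply: (Xg g gf) | apply: (Yg g gf)]; exists x.
Qed.

(** * Direct sums of cyclic subspaces *)

Section Decomposition.
Context (I : Type) (T : I -> nat) (e : I -> V) (W : I -> set V).
Hypothesis T_gt0 : forall a, (0 < T a)%N.
Hypothesis W_sub : forall a, is_subspace (W a).
Hypothesis W_inv : forall a, invariant_under f (W a).
Hypothesis W_cyc : forall a, cyclic_generator (T a) (e a) (W a).
Hypothesis W_dir : is_direct_sum W [set: V].

(** The map sends comb c (e a) + u to comb c y, where u is in the span U of the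
    other summands.  It is well defined because the sum of W a and U is direct
    and the coefficients c are determined by comb c (e a).  It commutes with f
    because U is f-invariant and f shifts the coefficients in the same way for
    e a and for y, both of which are killed by f^(T a). *)
Lemma exists_commuting_map a y : iter (T a) f y = 0 ->
  exists g : {linear V -> V}, [/\ g \o f =1 f \o g, g (e a) = y
    & forall b w, b <> a -> W b w -> g w = 0].
Proof.
move=> y0; case: (W_cyc a) => We e0 combW comb_free.
case: (W_dir) => W_tot W_indep.
pose U := span_set (\bigcup_(k in [set k | k <> a]) W k).
have Usub : is_subspace U by apply: span_setP.
have Uf u : U u -> U (f u).
  move=> Uu; apply: (span_set_sub (Y := [set x | U (f x)])) Uu.
    exact: subspace_preimage.
  move=> w [k ka Ww]; apply: sub_span_set; exists k => //.
  by apply: W_inv; exists w.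
pose R x z := exists c u, [/\ U u, x = comb (T a) c (e a) + u
  & z = comb (T a) c y].
have Rlin k x z x' z' : R x z -> R x' z' -> R (k *: x + x') (k *: z + z').
  move=> [c [u [Uu -> ->]]] [c' [u' [Uu' -> ->]]].
  exists (fun i => k * c i + c' i), (k *: u + u'); split.
  - exact: subspaceD Usub (subspaceZ _ Usub _) _.
  - by rewrite comb_linear scalerDr addrACA.
  - by rewrite comb_linear.
have RW b w : b <> a -> W b w -> R w 0.
  move=> ba Ww; exists (fun=> 0), w; rewrite !comb0 add0r; split=> //.
  by apply: sub_span_set; exists b.
have Rtot x : exists z, R x z.
  have : [set: V] x by [].
  rewrite W_tot => Wx.
  apply: (subspace_sum_sub (Y := [set x | exists z, R x z])) Wx => [|b w Ww].
    apply/is_subspaceP; split=> [|k x1 x2 [z1 Rz1] [z2 Rz2]].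
      by exists 0, (fun=> 0), 0; rewrite !comb0 addr0; split=> //; apply: subspace0.
    by exists (k *: z1 + z2); apply: Rlin.
  have [ba|/RW/(_ Ww) ?] := EM (b = a); last by exists 0.
  subst b; have [c ->] := combW _ Ww.
  by exists (comb (T a) c y), c, 0; rewrite addr0; split=> //; apply: subspace0.
have R0 z : R 0 z -> z = 0.
  move=> [c [u [Uu xE ->]]].
  have c0 : comb (T a) c (e a) = 0.
    suff c0 : [set 0 : V] (comb (T a) c (e a)) by exact: c0.
    apply: (W_indep a); split; first exact: comb_mem.
    have -> : comb (T a) c (e a) = - u.
      by apply/eqP; rewrite -addr_eq0 -xE.
    exact: subspaceN Usub Uu.
  by rewrite /comb big1 // => i _; rewrite (comb_free c) ?scale0r.
have [g gP] := linear_of_graph Rlin Rtot R0; exists g; split.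
- move=> x /=; have /gP[c [u [Uu xE gxE]]] : g x = g x by [].
  apply/esym/gP; exists (fun i => if i is j.+1 then c j else 0), (f u).
  split; first exact: Uf.
    by rewrite {1}xE linearD comb_shift.
  by rewrite gxE comb_shift.
- apply/esym/gP; exists (fun i => (i == 0%N)%:R), 0.
  by rewrite !comb_delta // addr0; split=> //; apply: subspace0.
- by move=> b w ba Ww; apply/esym/gP; apply: RW ba Ww.
Qed.

Lemma exists_commuting_projection a :
  exists g : {linear V -> V}, [/\ g \o f =1 f \o g,
    forall x, W a (g x), forall w, W a w -> g w = w
    & forall b w, b <> a -> W b w -> g w = 0].
Proof.
case: (W_cyc a) => We e0 combW _.
have [g [gf ge g0]] := exists_commuting_map e0; exists g.
have gid w : W a w -> g w = w.
  by move=> /combW[c ->]; rewrite comb_commute // ge.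
split=> // x; have : [set: V] x by [].
case: (W_dir) => -> _.
apply: (subspace_sum_sub (Y := [set x | W a (g x)])) => [|b w Ww].
  exact: subspace_preimage.
have [ba|ba] := EM (b = a); first by subst b; rewrite /= gid.
by rewrite /= (g0 b) //; apply: subspace0.
Qed.

(** Every vector x is the sum of its finitely many nonzero components, and these
    are images of x under projections commuting with f, so they stay in X. *)
Lemma hyperinvariant_generated X Y :
  hyperinvariant f X -> is_subspace Y ->
  (forall a w, W a w -> X w -> Y w) -> X `<=` Y.
Proof.
move=> Xhyp Ysub WXY x Xx.
have [g gP] := choice exists_commuting_projection.
(* Asking for the expansion over every duplicate-free list that contains s makes
   the property stable under linear combinations: concatenate the two lists.
   Counting repetitions needs a decidable equality, hence {classic I}. *)
pose good x (s : seq {classic I}) :=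
  forall s' : seq {classic I}, uniq s' -> {subset s <= s'} ->
    x = \sum_(a <- s') g a x.
suff [s xs] : exists s, good x s.
  rewrite (xs (undup s)) ?undup_uniq // => [|a]; last by rewrite mem_undup.
  apply: subspace_big => // a _; case: (gP a) => gf gW _ _.
  by apply: (WXY a) => //; apply: hyperinvariant_mem.
have : [set: V] x by [].
case: (W_dir) => -> _ Wx.
apply: (subspace_sum_sub (Y := [set x | exists s, good x s])) Wx => [|a w Ww].
  apply/is_subspaceP; split=> [|k x1 x2 [s1 xs1] [s2 xs2]].
    by exists [::] => s' _ _; rewrite big1 // => a _; rewrite linear0.
  exists (s1 ++ s2) => s' s'uniq sub_s'.
  have s1s' : {subset s1 <= s'}.
    by move=> a s1a; apply: sub_s'; rewrite mem_cat s1a.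
  have s2s' : {subset s2 <= s'}.
    by move=> a s2a; apply: sub_s'; rewrite mem_cat s2a orbT.
  rewrite {1}(xs1 s') // {1}(xs2 s') // scaler_sumr -big_split /=.
  by apply: eq_bigr => a _; rewrite linearP.
exists [:: a] => s' s'uniq sub_s'; have s'a := sub_s' a (mem_head _ _).
rewrite (bigD1_seq (a : {classic I})) //= big1 ?addr0.
  by case: (gP a) => _ _ ->.
move=> b /eqP ba; case: (gP b) => _ _ _ g0; apply: (g0 a) => // ab.
exact: ba.
Qed.

(** By [iter_mem_of_comb], every iterate of e a that occurs in w lies in X, hence
    has order at least r. *)
Lemma hyperinvariant_cyclic_sub X a r w :
  hyperinvariant f X -> (forall m, X (iter m f (e a)) -> (r <= m)%N) ->
  W a w -> X w -> (iter r f @` W a) w.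
Proof.
move=> Xhyp min_r Ww Xw; case: (W_cyc a) => We e0 combW _.
have [c wE] := combW _ Ww; subst w.
apply: mem_iter_image_comb => // i lt_i ci; apply: min_r.
apply: iter_mem_of_comb Xw lt_i ci => //; first by case: Xhyp.
exact: hyperinvariant_inv.
Qed.

(** Apply an endomorphism commuting with f that sends e a to f^d (e b); the
    inequality ensures that f^(T a) kills f^d (e b). *)
Lemma hyperinvariant_transfer X a b n d :
  hyperinvariant f X -> (T b <= T a + d)%N ->
  X (iter n f (e a)) -> X (iter (n + d) f (e b)).
Proof.
move=> Xhyp le_ba Xa; case: (W_cyc b) => _ eb0 _ _.
have y0 : iter (T a) f (iter d f (e b)) = 0.
  by rewrite -iterD; apply: iter_eq0W le_ba eb0.
have [g [gf ge _]] := exists_commuting_map y0.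
by have := hyperinvariant_mem Xhyp gf Xa; rewrite iter_commute // ge iterD.
Qed.

Lemma iter_cyclic_eq0 a n : iter n f (e a) = 0 -> (T a <= n)%N.
Proof.
move=> en0; case: (W_cyc a) => _ _ _ comb_free.
rewrite leqNgt; apply/negP => lt_n.
have /comb_free/(_ n lt_n)/eqP :
    comb (T a) (fun i => (i == n)%:R) (e a) = 0; last by rewrite eqxx oner_eq0.
apply: big1 => i _; case: eqP => [->|_]; last by rewrite scale0r.
by rewrite en0 scaler0.
Qed.

End Decomposition.
End Cyclic.

(** * Hyperinvariant subspaces of the block decomposition *)

Section Blocks.
Context {K : fieldType} {V : lmodType K} (f : {linear V -> V}).
Context (t : nat -> nat) (S : nat -> Type).
Context (W : forall j : nat, S j -> set V) (Vt : nat -> set V).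
Context (e : {j : nat & S j} -> V).
Hypothesis t_gt0 : forall j, (0 < t j)%N.
Hypothesis t_incr : forall j, (t j < t j.+1)%N.
Hypothesis S_inh : forall j, inhabited (S j).
Hypothesis W_sub : forall j (s : S j), is_subspace (W s).
Hypothesis W_inv : forall j (s : S j), invariant_under f (W s).
Hypothesis W_cyc :
  forall a, cyclic_generator f (t (tag a)) (e a) (W (tagged a)).
Hypothesis Vt_sum : forall j, is_direct_sum (@W j) (Vt j).
Hypothesis V_sum : is_direct_sum Vt [set: V].

Let T (a : {j : nat & S j}) := t (tag a).
Let WI (a : {j : nat & S j}) := W (tagged a).
Let T_gt0 a : (0 < T a)%N := t_gt0 (tag a).
Let WI_sub a : is_subspace (WI a) := W_sub (tagged a).
Let WI_inv a : invariant_under f (WI a) := @W_inv _ (tagged a).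
Let WI_dir : is_direct_sum WI [set: V] := is_direct_sum_sigma Vt_sum V_sum.

Let W_Vt j (s : S j) : W s `<=` Vt j.
Proof. by case: (Vt_sum j) => -> _; apply: (sub_subspace_sum (i := s)). Qed.

Let Vt_sub j Y : is_subspace Y -> (forall s : S j, W s `<=` Y) -> Vt j `<=` Y.
Proof. by case: (Vt_sum j) => -> _; apply: subspace_sum_sub. Qed.

Lemma iter_block_sub n j : iter n f @` Vt j `<=` Vt j.
Proof.
have Vt_subsp : is_subspace (Vt j).
  by case: (Vt_sum j) => -> _; apply: span_setP.
move=> _ [v Vv <-]; apply: (Vt_sub (Y := [set v | Vt j (iter n f v)])) Vv.
  exact: (subspace_preimage (iter n f)).
by move=> s w Ww; apply: (W_Vt (s := s)); apply: iter_invariant.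
Qed.

(** The exponent r j is the least r with f^r e in X, where e generates a summand
    of block j. *)
Lemma hyperinvariant_block_sum X : hyperinvariant f X ->
  exists r, admissible t r /\ X = subspace_sum (fun j => iter (r j) f @` Vt j).
Proof.
move=> Xhyp; have [Xsub _] := Xhyp.
have transfer := hyperinvariant_transfer T_gt0 WI_sub WI_inv W_cyc WI_dir Xhyp.
have e0 a : iter (t (tag a)) f (e a) = 0 by case: (W_cyc a).
have minr j : exists r, forall s : S j,
    X (iter r f (e (Tagged S s))) /\
    forall m, X (iter m f (e (Tagged S s))) -> (r <= m)%N.
  (* The exponent of one summand serves for its whole block, by transfer with no
     shift between summands of equal dimension. *)
  have [s0] := S_inh j.
  have exr : exists r, `[< X (iter r f (e (Tagged S s0))) >].
    by exists (t j); apply/asboolP; rewrite (e0 (Tagged S s0)); apply: subspace0.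
  case: (ex_minnP exr) => r /asboolP Xr min_r; exists r => s; split=> [|m Xm].
    by rewrite -[r]addn0; apply: transfer Xr; rewrite addn0.
  apply: min_r; apply/asboolP; rewrite -[m]addn0.
  by apply: transfer Xm; rewrite addn0.
have [r rP] := choice minr; exists r; split.
  split=> [j|j l le_jl]; first have [s] := S_inh j.
    have [_] := rP j s; apply; rewrite (e0 (Tagged S s)); exact: subspace0.
  have [s] := S_inh j; have [s'] := S_inh l.
  have [Xj min_j] := rP j s; have [Xl min_l] := rP l s'.
  have le_t : (t j <= t l)%N.
    by apply: (homo_leq leqnn leq_trans) le_jl => i; apply: ltnW.
  split.
    by apply: min_j; rewrite -[r l]addn0; apply: transfer Xl; rewrite addn0.
  have : (r l <= r j + (t l - t j))%N.
    by apply: min_l; apply: transfer Xj; rewrite /T /= subnKC.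
  by lia.
apply/seteqP; split.
  apply: (hyperinvariant_generated T_gt0 WI_sub WI_inv W_cyc WI_dir) => //.
    exact: span_setP.
  case=> j s w Ww Xw; have [_ min_r] := rP j s.
  have [v Wv <-] := hyperinvariant_cyclic_sub WI_sub WI_inv W_cyc Xhyp min_r Ww Xw.
  by apply: (sub_subspace_sum (i := j)); exists v => //; apply: W_Vt Wv.
apply: subspace_sum_sub => // j _ [v Vv <-].
apply: (Vt_sub (Y := [set v | X (iter (r j) f v)])) Vv.
  exact: (subspace_preimage (iter (r j) f)).
move=> s w Ww /=; have [_ _ combW _] := W_cyc (Tagged S s).
have [c ->] := combW _ Ww; rewrite (@comb_commute _ _ _ (iter (r j) f)) //.
  apply: comb_mem => //; first exact: hyperinvariant_inv.
  by case: (rP j s).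
by move=> x; rewrite /= -iterS -iterSr.
Qed.

(** Both inclusions are checked on the cyclic summands.  For the one from right
    to left, a vector of a summand of dimension t l killed by f^(t j) is
    f^(t l - t j) of another one, and admissibility gives
    r l <= r j + (t l - t j). *)
Lemma block_sum_im_ker r : admissible t r ->
  subspace_sum (fun j => iter (r j) f @` Vt j) =
  subspace_sum (fun j => im_pow f (r j) `&` ker_pow f (t j - r j)).
Proof.
move=> [le_rt r_mono]; apply/seteqP; split.
  apply: subspace_sum_sub => [|j _ [v Vv <-]]; first exact: span_setP.
  apply: (sub_subspace_sum (i := j)); split; first by exists v.
  rewrite /ker_pow /= -iterD subnK //.
  have ker_hyp := hyperinvariant_ker_pow f (t j).
  have [ker_sub _] := ker_hyp.
  apply: (Vt_sub ker_sub) Vv => s w Ww.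
  have [_ es0 combW _] := W_cyc (Tagged S s).
  by have [c ->] := combW _ Ww; apply: comb_mem => //; apply: hyperinvariant_inv.
apply: subspace_sum_sub => [|j _ [[v _ <-]]]; first exact: span_setP.
rewrite {1}/ker_pow /= -iterD subnK // => v0.
set Y := subspace_sum _.
apply: (hyperinvariant_generated T_gt0 WI_sub WI_inv W_cyc WI_dir
  (hyperinvariant_ker_pow f (t j)) (Y := [set v | Y (iter (r j) f v)])) v0.
  by apply: (subspace_preimage (iter (r j) f)); apply: span_setP.
case=> l s w Ww kw /=.
have min_m m : ker_pow f (t j) (iter m f (e (Tagged S s))) -> (t l - t j <= m)%N.
  rewrite /ker_pow /= -iterD => /(iter_cyclic_eq0 W_cyc) /=.
  by rewrite leq_subLR.
have [w' Ww' <-] := hyperinvariant_cyclic_sub WI_sub WI_inv W_cyc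
  (hyperinvariant_ker_pow f (t j)) min_m Ww kw.
have le_r : (r l <= r j + (t l - t j))%N.
  by have := le_rt j; have := le_rt l; case/orP: (leq_total j l) => /r_mono; lia.
apply: (sub_subspace_sum (i := l)).
exists (iter (r j + (t l - t j) - r l) f w').
  by apply: (W_Vt (s := s)); apply: iter_invariant => //; apply: W_inv.
by rewrite -!iterD subnKC.
Qed.

Lemma hyperinvariant_im_ker_sum r :
  hyperinvariant f
    (subspace_sum (fun j => im_pow f (r j) `&` ker_pow f (t j - r j))).
Proof.
apply: hyperinvariant_sum => j; apply: hyperinvariantI.
  exact: hyperinvariant_im_pow.
exact: hyperinvariant_ker_pow.
Qed.

End Blocks.

Theorem theorem1p1 (K : fieldType) (V : lmodType K) (f : {linear V -> V})
    (t : nat -> nat) (S : nat -> Type)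
    (W : forall j : nat, S j -> set V) (Vt : nat -> set V)
    (f_nil : locally_nilpotent f)
    (t_gt0 : forall j, (0 < t j)%N)
    (t_incr : forall j, (t j < t j.+1)%N)
    (S_inh : forall j, inhabited (S j))
    (W_sub : forall j (s : S j), is_subspace (W j s))
    (W_inv : forall j (s : S j), invariant_under f (W j s))
    (W_cyc : forall j (s : S j), iso_quotXn f (t j) (W j s))
    (Vt_sum : forall j, is_direct_sum (W j) (Vt j))
    (V_sum : is_direct_sum Vt [set: V])
    (X : set V) (X_sub : is_subspace X) :
  (hyperinvariant f X <->
   exists r : nat -> nat, admissible t r /\
     is_direct_sum (fun j => iter (r j) f @` Vt j) X) /\
  (hyperinvariant f X <->
   exists r : nat -> nat, admissible t r /\
     X = subspace_sum (fun j => im_pow f (r j) `&` ker_pow f (t j - r j))).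

Proof.
have [e W_bas] := choice (fun a : {j : nat & S j} =>
  iso_quotXn_cyclic (t_gt0 (tag a)) (@W_cyc _ (tagged a))).
have block := hyperinvariant_block_sum t_gt0 t_incr S_inh W_sub W_inv W_bas
  Vt_sum V_sum.
have im_ker := block_sum_im_ker t_gt0 W_sub W_inv W_bas Vt_sum V_sum.
split; split.
- move=> /block[r [r_adm ->]]; exists r; split=> //.
  by apply: is_direct_sum_sub V_sum _ => j; apply: iter_block_sub.
- move=> [r [r_adm [-> _]]]; rewrite im_ker //.
  exact: hyperinvariant_im_ker_sum.
- by move=> /block[r [r_adm ->]]; exists r; rewrite im_ker.
- by move=> [r [_ ->]]; apply: hyperinvariant_im_ker_sum.
Qed.
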